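(* Let $0\le k<n$ be integers. Then, for any polynomial $f\in\mathbb{C}[X]$ of degree $<2n+k$, $$\left|\frac{f^{(k)}(0)}{k!}\right|+\left|\frac{f^{(n+k)}(0)}{(n+k)!}\right|\le\|f\|_\infty.$$ Moreover, equality occurs for some polynomial of degree $\le 2n-2$.
   Context: For a function $f$ on the open complex unit disk $\mathbb{D}$, $\|f\|_\infty=\sup\{|f(z)|: z\in\mathbb{D}\}$. $f^{(j)}$ denotes the $j$-th derivative of $f$. *)

(* Defs.v *)
From mathcomp Require Import all_boot all_order all_algebra.
From mathcomp Require Import all_classical all_reals all_analysis.
From mathcomp Require Import complex.

Set Implicit Arguments.
Unset Strict Implicit.
Unset Printing Implicit Defensive.

Import GRing.Theory Num.Theory.
Local Open Scope classical_set_scope.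
Local Open Scope ring_scope.
Local Open Scope complex_scope.

(* [normc] is the R-valued modulus on [R[i]]; the norm [`|z|] of the library
   takes its values in [R[i]] itself. *)
Definition cabs (R : realType) (z : R[i]) : R := ComplexField.Normc.normc z.

Definition unit_disk (R : realType) : set R[i] := [set z | cabs z < 1].

(* The supremum is taken in the extended reals, so an unbounded function on the
   disk has norm +oo (the real-valued [sup] would be 0). *)
Definition disk_supnorm (R : realType) (f : R[i] -> R[i]) : \bar R :=
  ereal_sup [set (cabs (f z))%:E | z in @unit_disk R].

(* Main.v *)
Require Import Defs.
From mathcomp Require Import all_boot all_order all_algebra.
From mathcomp Require Import all_classical all_reals all_analysis.
From mathcomp Require Import complex.
From mathcomp Require Import cyclic separable cyclotomic zify ring.

(** Write [f = \sum_j a_j X^j].  Averaging [f] over the [n] points of modulus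
    [r] whose [n]-th power is a prescribed number, with characters of the group
    of [n]-th roots of unity as weights, keeps only the coefficients whose index
    lies in a chosen class modulo [n] ([sum_prim_root_horner]).  Since [k < n],
    the only indices below [2n + k] congruent to [k] modulo [n] are [k] and
    [n + k], so the average has modulus [|a_k r^k + c a_(n+k) r^(n+k)|], where
    [c] is a unimodular number that the base point of the average can be chosen
    to produce.  Taking [c] to align the arguments of the two terms, and
    bounding the average by the maximum of [|f|] on the circle of radius [r],
    gives [|a_k| r^k + |a_(n+k)| r^(n+k) <= ||f||] ([norm_coef_pair_le]); then
    [r] tends to [1].  The monomial [X^k] attains equality, since its modulus
    is at most [1] on the disk. *)

Import Order.TTheory GRing.Theory Num.Theory.
Import numFieldTopology.Exports numFieldNormedType.Exports.
Local Open Scope ring_scope.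
Local Open Scope complex_scope.

(** The roots of ['X^n - 1] are simple, so there are [n] of them, and a finite
    group of [n] roots of unity in a field is cyclic. *)
Lemma prim_root_exists (F : closedFieldType) (n : nat) :
  n%:R != 0 :> F -> exists z : F, n.-primitive_root z.
Proof.
move=> nF; have n_gt0 : (0 < n)%N by case: n nF; rewrite ?eqxx.
have [s Ds] := closed_field_poly_normal ('X^n - 1 : {poly F}).
rewrite (monicP _) ?monicXnsubC // scale1r in Ds.
have s_roots : all n.-unity_root s.
  by apply/allP => z; rewrite -root_prod_XsubC -Ds.
have s_uniq : uniq s.
  by rewrite -separable_prod_XsubC -Ds separable_Xn_sub_1.
have s_size : (n <= size s)%N.
  by rewrite -ltnS -(size_prod_XsubC s id) -Ds size_XnsubC.
by have /hasP[z _ z_prim] := has_prim_root n_gt0 s_roots s_uniq s_size; exists z.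
Qed.

(** Unless [z ^+ m] is [1], the sum is geometric and its numerator
    [(z ^+ m) ^+ n - 1] vanishes. *)
Lemma sum_prim_root_expr (F : idomainType) (n : nat) (z : F) (m : nat) :
  n.-primitive_root z ->
  \sum_(i < n) (z ^+ m) ^+ i = if (n %| m)%N then n%:R else 0.
Proof.
move=> zn; have [n_m|n'm] := ifP.
  have -> : z ^+ m = 1 by apply/eqP; rewrite -(prim_order_dvd zn).
  by under eq_bigr do rewrite expr1n; rewrite sumr_const card_ord.
have zm1 : z ^+ m - 1 != 0 by rewrite subr_eq0 -(prim_order_dvd zn) n'm.
apply: (mulfI zm1).
by rewrite -subrX1 exprAC (prim_expr_order zn) expr1n subrr mulr0.
Qed.

(** The discrete Fourier transform over the [n]-th roots of unity selects the
    coefficients in one residue class of indices. *)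
Lemma sum_prim_root_horner (F : idomainType) (n : nat) (z u : F) (s N : nat)
    (p : {poly F}) :
  n.-primitive_root z -> (size p <= N)%N ->
  \sum_(i < n) (z ^+ s) ^+ i * p.[u * z ^+ i]
    = n%:R * \sum_(j < N | (n %| s + j)%N) p`_j * u ^+ j.
Proof.
move=> zn pN; under eq_bigr => i _.
  rewrite (horner_coef_wide _ pN) mulr_sumr.
  under eq_bigr => j _.
    have -> : (z ^+ s) ^+ i * (p`_j * (u * z ^+ i) ^+ j)
            = p`_j * u ^+ j * (z ^+ (s + j)) ^+ i.
      by rewrite exprMn -!exprM mulnDl exprD (mulnC i); ring.
  over.
over.
rewrite exchange_big /= mulr_sumr [RHS]big_mkcond /=; apply: eq_bigr => j _.
rewrite -mulr_sumr (sum_prim_root_expr _ _ _ _ zn).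
by case: ifP => _; rewrite ?mulr0 // mulrC.
Qed.

(** The factor [c] rotates [b] to the argument of [a], which makes the triangle
    inequality an equality. *)
Lemma exists_norm1_aligned (C : numClosedFieldType) (a b : C) :
  exists2 c : C, `|c| = 1 & `|a + c * b| = `|a| + `|b|.
Proof.
have polar (x : C) : exists2 v : C, `|v| = 1 & x = `|x| * v.
  have [->|x0] := eqVneq x 0; first by exists 1; rewrite ?normr1 ?normr0 ?mul0r.
  exists (x / `|x|); last by rewrite mulrC divfK // normr_eq0.
  by rewrite normrM normfV normr_id divff // normr_eq0.
have [v v1 Da] := polar a; have [w w1 Db] := polar b.
have w0 : w != 0 by rewrite -normr_eq0 w1 oner_eq0.
exists (v / w); first by rewrite normrM normfV v1 w1 divr1.
have -> : a + v / w * b = (`|a| + `|b|) * v.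
  by rewrite {1}Da {1}Db mulrCA divfK // mulrDl.
by rewrite normrM v1 mulr1 ger0_norm // addr_ge0.
Qed.

(** The weighted average of [p] over the points [w * r * z ^+ i], where [z] is a
    primitive [n]-th root of unity and [w ^+ n] is the aligning factor, equals
    [w ^+ k] times the aligned sum of the two terms, so its modulus is the
    left-hand side; all its sample points lie on the circle of radius [r]. *)
Lemma norm_coef_pair_le (C : numClosedFieldType) (k n : nat) (p : {poly C})
    (r M : C) :
  (k < n)%N -> (size p <= 2 * n + k)%N -> 0 <= r ->
  (forall z, `|z| = r -> `|p.[z]| <= M) ->
  `|p`_k| * r ^+ k + `|p`_(n + k)| * r ^+ (n + k) <= M.
Proof.
move=> kn pN r0 pM; have n0 : (0 < n)%N by exact: leq_ltn_trans kn.
have [z zn] : exists z : C, n.-primitive_root z.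
  by apply: prim_root_exists; rewrite pnatr_eq0 -lt0n.
have z1 : `|z| = 1.
  apply/eqP; rewrite -(pexpr_eq1 n0) // -normrX (prim_expr_order zn).
  by rewrite normr1.
have [c c1 cE] :=
  exists_norm1_aligned C (p`_k * r ^+ k) (p`_(n + k) * r ^+ (n + k)).
have [w wn] : exists w : C, w ^+ n = c by exists (n.-root c); rewrite rootCK.
have w1 : `|w| = 1 by apply/eqP; rewrite -(pexpr_eq1 n0) // -normrX wn c1.
(* Indices congruent to k are those whose sum with n - k is divisible by n. *)
have := sum_prim_root_horner C n z (w * r) (n - k) (2 * n + k) p zn pN.
have lt_k : (k < 2 * n + k)%N by lia.
have lt_nk : (n + k < 2 * n + k)%N by lia.
rewrite (bigD1 (Ordinal lt_k)) /=; last by rewrite subnK // ltnW.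
rewrite (bigD1 (Ordinal lt_nk)) /=; last first.
  by rewrite -val_eqE /= addnCA subnK ?(ltnW kn) // dvdn_addr // dvdnn /=; lia.
rewrite [X in _ + (_ + X)]big1 ?addr0 => [|j /andP[/andP[/dvdnP[q Dq] jk] jnk]]; last first.
  (* n - k + j = q * n with j < 2n + k forces q < 3; q = 0 would need n <= k,
     and q = 1, 2 are the two indices already extracted. *)
  exfalso; move: jk jnk; rewrite -!val_eqE /= => jk jnk.
  have := ltn_ord j; case: q Dq => [|[|[|q]]]; nia.
have -> : p`_k * (w * r) ^+ k + p`_(n + k) * (w * r) ^+ (n + k)
        = w ^+ k * (p`_k * r ^+ k + c * (p`_(n + k) * r ^+ (n + k))).
  by rewrite !exprMn [w ^+ (n + k)]exprD wn; ring.
move=> /(congr1 Num.norm).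
rewrite normrM normr_nat normrM normrX w1 expr1n mul1r cE => sumE.
have rX m : `|r ^+ m| = r ^+ m by rewrite ger0_norm // exprn_ge0.
rewrite !normrM !rX in sumE.
have n0C : 0 < n%:R :> C by rewrite ltr0n.
rewrite -(ler_pM2l n0C) -sumE.
apply: le_trans (ler_norm_sum _ _ _) _.
have -> : n%:R * M = \sum_(i < n) M by rewrite sumr_const card_ord mulr_natl.
apply: ler_sum => i _.
rewrite normrM !normrX z1 !expr1n mul1r; apply: pM.
by rewrite !normrM normrX w1 z1 expr1n mulr1 mul1r ger0_norm.
Qed.

Lemma horner0_derivn_fact (F : numFieldType) (m : nat) (p : {poly F}) :
  p^`(m).[0] / m`!%:R = p`_m.
Proof.
by rewrite horner_coef0 coef_derivn addn0 ffactnn -[p`_m *+ _]mulr_natr mulfK.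
Qed.

Lemma disk_supnorm_ge (R : realType) (f : R[i] -> R[i]) (z : R[i]) :
  cabs z < 1 -> ((cabs (f z))%:E <= disk_supnorm f)%E.
Proof. by move=> z1; apply: ereal_sup_ubound; exists z. Qed.

(** The supremum over the open disk only controls circles of radius [r < 1], so
    the inequality at radius [1] is reached as a left limit. *)
Lemma cabs_coef_pair_le_supnorm (R : realType) (k n : nat) (f : {poly R[i]}) :
  (k < n)%N -> (size f <= 2 * n + k)%N ->
  ((cabs f`_k + cabs f`_(n + k))%:E <= disk_supnorm (fun z => f.[z]))%E.
Proof.
move=> kn fN; have cabsE (z : R[i]) : `|z| = (cabs z)%:C by [].
have f_le (z : R[i]) := disk_supnorm_ge R (fun z => f.[z]) z.
case: (disk_supnorm _) f_le => [M| |] f_le; last 1 first.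
- have := f_le 0; rewrite /cabs ComplexField.Normc.normc0 ltr01 => /(_ isT).
  by rewrite leeNy_eq.
- rewrite lee_fin.
  set A := cabs f`_k; set B := cabs f`_(n + k).
  have radial (r : R) : 0 <= r < 1 -> A * r ^+ k + B * r ^+ (n + k) <= M.
    move=> /andP[r0 r1]; rewrite -lecR rmorphD !rmorphM !rmorphXn /=.
    apply: norm_coef_pair_le => //; first by rewrite lecR.
    move=> z; rewrite !cabsE => /(congr1 (@complex.Re R)) /= zr.
    by rewrite lecR -lee_fin; apply: f_le; rewrite zr.
  have cvgX m : ((fun r : R => r ^+ m) x @[x --> 1^'-] --> (1 : R))%classic.
    rewrite -{2}(expr1n R m); apply: cvg_at_left_filter; exact: exprn_continuous.
  have cvgAB : (A * r ^+ k + B * r ^+ (n + k) @[r --> 1^'-] --> A + B)%classic.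
    rewrite -{2}(mulr1 A) -{2}(mulr1 B).
    by apply: cvgD; apply: cvgM; first [exact: cvg_cst | exact: cvgX].
  apply: (cvgr_to_le cvgAB).
  near=> r; apply: radial; apply/andP; split; last by near: r; exact: nbhs_left_lt.
  by near: r; apply: nbhs_left_ge; exact: ltr01.
- by rewrite leey.
Unshelve. all: by end_near. Qed.

(* [size f] is the degree plus one (and 0 for the zero polynomial). *)
Theorem corollary2p7 (R : realType) (k n : nat) (hkn : (k < n)%N) :
  (forall f : {poly R[i]}, (size f <= 2 * n + k)%N ->
     ((cabs (f^`(k).[0] / (k`!)%:R)
       + cabs (f^`(n + k).[0] / ((n + k)`!)%:R))%:E
      <= disk_supnorm (fun z => f.[z]))%E)
  /\
  (exists f : {poly R[i]},
     [/\ f != 0,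
         (size f <= (2 * n - 2).+1)%N
       & (cabs (f^`(k).[0] / (k`!)%:R)
          + cabs (f^`(n + k).[0] / ((n + k)`!)%:R))%:E
         = disk_supnorm (fun z => f.[z])]).
Proof.
split=> [f fN|]; first by rewrite !horner0_derivn_fact cabs_coef_pair_le_supnorm.
exists 'X^k; split; first by rewrite -size_poly_eq0 size_polyXn.
  by rewrite size_polyXn; lia.
(* The lower bound on the norm is the inequality itself, applied to 'X^k. *)
rewrite !horner0_derivn_fact; apply/eqP; rewrite eq_le; apply/andP; split.
  by apply: cabs_coef_pair_le_supnorm; rewrite // size_polyXn; lia.
have -> : cabs ('X^k : {poly R[i]})`_k + cabs ('X^k : {poly R[i]})`_(n + k) = 1.
  rewrite !coefXn eqxx -[X in _ == X]add0n eqn_add2r gtn_eqF; last by lia.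
  by rewrite /cabs ComplexField.Normc.normc1 ComplexField.Normc.normc0 addr0.
apply: ge_ereal_sup => _ [z z1 <-]; rewrite lee_fin hornerXn -lecR.
have cabsE (x : R[i]) : (cabs x)%:C = `|x| by [].
by rewrite cabsE normrX exprn_ile1 // -cabsE lecR ltW.
Qed.
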